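(* Let $r_1\ge r_2\ge r_3\ge r_4>0$. Consider the booby trap search game with $n=4$ boxes, rewards $r_1,\dots,r_4$ and $k=2$ booby traps on the complete hypergraph on $\{1,2,3,4\}$. Then at least one of the three Searcher mixed strategies A, B, C (defined in the context) is optimal for the Searcher, and the value of the game is $$V=\max\{V_A,V_B,V_C\},$$ where $$V_A=\frac{2}{\frac1{r_1}+\frac1{r_2}+\frac1{r_3}+\frac1{r_4}},\qquad V_B=\frac{1}{\frac1{r_1}+\frac1{r_2}+\frac1{r_3+r_4}},$$ $$V_C=\frac{2}{\frac1{r_1}+\frac1{r_2}+\frac1{r_3}+\frac1{r_1+r_4}+\frac1{r_2+r_4}+\frac1{r_3+r_4}}.$$
   Context: The booby trap search game: there are $n$ boxes, identified with the vertex set $[n]=\{1,\dots,n\}$ of a hypergraph $G$ with set of hyperedges $E\subseteq 2^{[n]}$. Box $i$ contains a reward $r_i$. A Hider pure strategy is a set $H\subseteq[n]$ with $|H|=k$ (the booby trapped boxes). A Searcher pure strategy is a hyperedge $S\in E$ (the boxes opened). The payoff (to the maximizing Searcher, in a zero-sum game against the minimizing Hider) is $R(S,H)=\sum_{i\in S}r_i$ if $S\cap H=\emptyset$, and $R(S,H)=0$ otherwise. Mixed strategies are probability distributions over pure strategies, and payoffs extend by expectation. Value and optimal strategies are in the usual sense for finite two-person zero-sum games. In the complete hypergraph, $E=2^{[n]}$, so the Searcher may open any subset of $[n]$. Searcher mixed strategies for $n=4$, $k=2$ (each chooses a set $S$ from a given family with probability proportional to $1/\sum_{i\in S}r_i$):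 Strategy A: open $\{i\}$ with probability $\dfrac{1/r_i}{1/r_1+1/r_2+1/r_3+1/r_4}$, $i=1,2,3,4$. Strategy B: open $\{i\}$ with probability $\dfrac{1/r_i}{1/r_1+1/r_2+1/(r_3+r_4)}$ for $i=1,2$, and open $\{3,4\}$ with probability $\dfrac{1/(r_3+r_4)}{1/r_1+1/r_2+1/(r_3+r_4)}$. Strategy C: with $D=\frac1{r_1}+\frac1{r_2}+\frac1{r_3}+\frac1{r_1+r_4}+\frac1{r_2+r_4}+\frac1{r_3+r_4}$, open $\{i\}$ with probability $\dfrac{1/r_i}{D}$ and open $\{i,4\}$ with probability $\dfrac{1/(r_i+r_4)}{D}$, for $i=1,2,3$. *)

(* Defs.v *)
From HB Require Import structures.
From mathcomp Require Import all_boot all_order all_algebra.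

Set Implicit Arguments.
Unset Strict Implicit.
Unset Printing Implicit Defensive.

Import Order.TTheory GRing.Theory Num.Theory.
Local Open Scope ring_scope.

Section ZeroSumGames.
Variables (R : realFieldType) (A B : finType).

Definition mixed (T : finType) (P : {set T}) (p : {ffun T -> R}) : Prop :=
  [/\ forall t, 0 <= p t, forall t, t \notin P -> p t = 0 & \sum_t p t = 1].

(* Pure strategies: X for the maximizer, Y for the minimizer; u is what the
   minimizer pays. *)
Variables (X : {set A}) (Y : {set B}) (u : A -> B -> R).

Definition expected_payoff (p : {ffun A -> R}) (q : {ffun B -> R}) : R :=
  \sum_a \sum_b p a * q b * u a b.

Definition max_secures (p : {ffun A -> R}) (v : R) : Prop :=
  mixed X p /\ forall q, mixed Y q -> v <= expected_payoff p q.

Definition min_secures (q : {ffun B -> R}) (v : R) : Prop :=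
  mixed Y q /\ forall p, mixed X p -> expected_payoff p q <= v.

(* There is at most one such v, and it is both the maximin and the minimax. *)
Definition is_value (v : R) : Prop :=
  (exists p, max_secures p v) /\ (exists q, min_secures q v).

Definition max_optimal (p : {ffun A -> R}) : Prop :=
  exists2 v, is_value v & max_secures p v.

End ZeroSumGames.

Section BoobyTrap.
Variables (R : realFieldType) (n : nat).
Implicit Types (E F : {set {set 'I_n}}) (r : 'I_n -> R) (S H : {set 'I_n}).

Definition reward r S : R := \sum_(i in S) r i.

Definition payoff r S H : R := if [disjoint S & H] then reward r S else 0.

Definition hider_pure (k : nat) : {set {set 'I_n}} := [set H : {set 'I_n} | #|H| == k].

Definition booby_trap_value E k r (v : R) : Prop :=
  is_value E (hider_pure k) (payoff r) v.

Definition searcher_optimal E k r (p : {ffun {set 'I_n} -> R}) : Prop :=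
  max_optimal E (hider_pure k) (payoff r) p.

Definition inverse_reward_strategy r F : {ffun {set 'I_n} -> R} :=
  [ffun S => if S \in F
             then (reward r S)^-1 / \sum_(T in F) (reward r T)^-1 else 0].

End BoobyTrap.

Definition complete_hypergraph (n : nat) : {set {set 'I_n}} := setT.

(* Boxes 1, 2, 3, 4 are the ordinals 0, 1, 2, 3. *)
Definition box1 : 'I_4 := @Ordinal 4 0 isT.
Definition box2 : 'I_4 := @Ordinal 4 1 isT.
Definition box3 : 'I_4 := @Ordinal 4 2 isT.
Definition box4 : 'I_4 := @Ordinal 4 3 isT.

Definition familyA : {set {set 'I_4}} :=
  [set [set box1]; [set box2]; [set box3]; [set box4]].

Definition familyB : {set {set 'I_4}} :=
  [set [set box1]; [set box2]; [set box3; box4]].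

Definition familyC : {set {set 'I_4}} :=
  [set [set box1]; [set box2]; [set box3];
       [set box1; box4]; [set box2; box4]; [set box3; box4]].

Local Ltac neq_boxes :=
  let e := fresh "e" in
  repeat (apply/andP; split); apply/eqP => /setP e;
  move: (e box1) (e box2) (e box3) (e box4); rewrite !inE; by [].

Section FourBoxes.
Variables (R : realFieldType) (r : 'I_4 -> R).
Let r1 := r box1.
Let r2 := r box2.
Let r3 := r box3.
Let r4 := r box4.

Definition strategyA := inverse_reward_strategy r familyA.
Definition strategyB := inverse_reward_strategy r familyB.
Definition strategyC := inverse_reward_strategy r familyC.

Definition valueA : R := 2 / (1 / r1 + 1 / r2 + 1 / r3 + 1 / r4).

Definition valueB : R := 1 / (1 / r1 + 1 / r2 + 1 / (r3 + r4)).

Definition valueC : R :=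
  2 / (1 / r1 + 1 / r2 + 1 / r3
       + 1 / (r1 + r4) + 1 / (r2 + r4) + 1 / (r3 + r4)).

Lemma reward1 i : reward r [set i] = r i.
Proof. by rewrite /reward big_set1. Qed.

Lemma reward2 i j : i != j -> reward r [set i; j] = r i + r j.
Proof. by move=> ij; rewrite /reward big_setU1 ?inE //= big_set1. Qed.

Lemma normalizerA :
  \sum_(T in familyA) (reward r T)^-1 = 1 / r1 + 1 / r2 + 1 / r3 + 1 / r4.
Proof.
rewrite /familyA -!setUA !big_setU1 ?big_set1;
  first by rewrite /= !reward1 !div1r !addrA.
all: by rewrite !inE ?negb_or -?andbA; neq_boxes.
Qed.

Lemma normalizerB :
  \sum_(T in familyB) (reward r T)^-1 = 1 / r1 + 1 / r2 + 1 / (r3 + r4).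
Proof.
rewrite /familyB -!setUA !big_setU1 ?big_set1;
  first by rewrite /= !reward1 !reward2 // !div1r !addrA.
all: by rewrite !inE ?negb_or -?andbA; neq_boxes.
Qed.

Lemma normalizerC :
  \sum_(T in familyC) (reward r T)^-1 =
  1 / r1 + 1 / r2 + 1 / r3 + 1 / (r1 + r4) + 1 / (r2 + r4) + 1 / (r3 + r4).
Proof.
rewrite /familyC -!setUA !big_setU1 ?big_set1;
  first by rewrite /= !reward1 !reward2 // !div1r !addrA.
all: by rewrite !inE ?negb_or -?andbA; neq_boxes.
Qed.

End FourBoxes.

(* Main.v *)
(** The set left free of traps is a random pair [U], and opening [S] pays
    [reward r S] exactly when [S] is contained in [U].  Rescaling the Hider's
    strategy by the value, the Hider maximizes the total weight of a fractional
    edge packing of K4 subject to degree bounds [1 / r_i] and capacities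
    [1 / (r_i + r_j)].  The strategies A, B, C are three dual solutions, so
    their values are lower bounds; it remains to exhibit, in each of three
    exhaustive regions of rewards, a packing meeting one of these bounds. *)

Require Import Defs.

From mathcomp Require Import all_boot all_order all_algebra.
From mathcomp Require Import ring lra.

Set Implicit Arguments.
Unset Strict Implicit.
Unset Printing Implicit Defensive.

Import Order.TTheory GRing.Theory Num.Theory.
Local Open Scope ring_scope.

(** * Zero-sum games: testing against pure strategies, and weak duality *)

Section Games.
Variables (R : realFieldType) (A B : finType).
Variables (X : {set A}) (Y : {set B}) (u : A -> B -> R).
Implicit Types (p : {ffun A -> R}) (q : {ffun B -> R}).

(** A mixed reply averages pure ones, so a bound against every pure strategy passes to the expected
    payoff. *)
Lemma max_securesP p v : mixed X p ->
  (forall b, b \in Y -> v <= \sum_a p a * u a b) -> max_secures X Y u p v.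
Proof.
move=> pX ub; split=> // q [q0 qY q1].
rewrite /expected_payoff exchange_big /= -[v]mulr1 -q1 mulr_sumr.
apply: ler_sum => b _; case: (boolP (b \in Y)) => bY; last first.
  by rewrite qY // mulr0 big1 // => a _; rewrite mulr0 mul0r.
under eq_bigr => a _ do rewrite mulrAC.
by rewrite -mulr_suml ler_wpM2r ?q0 ?ub.
Qed.

Lemma min_securesP q v : mixed Y q ->
  (forall a, a \in X -> \sum_b q b * u a b <= v) -> min_secures X Y u q v.
Proof.
move=> qY ub; split=> // p [p0 pX p1].
rewrite /expected_payoff -[v]mul1r -p1 mulr_suml.
apply: ler_sum => a _; case: (boolP (a \in X)) => aX; last first.
  by rewrite pX // mul0r big1 // => b _; rewrite !mul0r.
under eq_bigr => b _ do rewrite -mulrA.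
by rewrite -mulr_sumr ler_wpM2l ?p0 ?ub.
Qed.

Lemma secures_le p q v w :
  max_secures X Y u p v -> min_secures X Y u q w -> v <= w.
Proof. by move=> [pX pv] [qY qw]; exact: le_trans (pv q qY) (qw p pX). Qed.

Lemma secures_optimal p q v :
  max_secures X Y u p v -> min_secures X Y u q v -> max_optimal X Y u p.
Proof. by move=> pv qv; exists v => //; split; [exists p | exists q]. Qed.

End Games.

(** * The guarantee of inverse-reward strategies *)

(** The weight of [S] cancels its reward, so every member of [F] that avoids [H] contributes the
    same amount. The payoff is the number of such members divided by the normalizer. *)
Lemma inverse_reward_secures (R : realFieldType) n k (r : 'I_n -> R)
    (F E : {set {set 'I_n}}) (m : nat) :
    (forall i, 0 < r i) -> F \subset E -> F != set0 -> set0 \notin F ->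
    (forall H : {set 'I_n}, #|H| = k -> m%:R <= \sum_(S in F) [disjoint S & H]%:R :> R) ->
  max_secures E (hider_pure n k) (payoff r) (inverse_reward_strategy r F)
    (m%:R / \sum_(S in F) (reward r S)^-1).
Proof.
move=> r_gt0 FE /set0Pn [S0 S0F] F0 hm.
have rew_gt0 S : S \in F -> 0 < reward r S.
  move=> SF; have /set0Pn[i iS] : S != set0 by apply: contraNneq F0 => <-.
  rewrite /reward (bigD1 i) //= ltr_pwDl //.
  by apply: sumr_ge0 => j _; exact: ltW.
set N := \sum_(S in F) _.
have N_gt0 : 0 < N.
  rewrite /N (bigD1 S0) //= ltr_pwDl ?invr_gt0 ?rew_gt0 //.
  by apply: sumr_ge0 => S /andP[SF _]; rewrite invr_ge0 ltW ?rew_gt0.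
apply: max_securesP.
  split=> [S|S SE|].
  - rewrite ffunE; case: ifP => // SF.
    by rewrite divr_ge0 ?invr_ge0 ?(ltW N_gt0) ?ltW ?rew_gt0.
  - by rewrite ffunE ifN //; apply: contra SE; apply/subsetP.
  - under eq_bigr => S _ do rewrite ffunE.
    by rewrite -big_mkcond /= -mulr_suml divff ?gt_eqF.
move=> H; rewrite inE => /eqP Hk.
under eq_bigr => S _ do rewrite ffunE (fun_if ( *%R^~ _)) mul0r.
rewrite -big_mkcond /=.
apply: le_trans (_ : (\sum_(S in F) [disjoint S & H]%:R) / N <= _).
  by rewrite ler_wpM2r ?hm // invr_ge0 ltW.
rewrite mulr_suml le_eqVlt; apply/orP; left; apply/eqP/eq_bigr => S SF.
rewrite /payoff; case: ifP => _; last by rewrite mulr0 mul0r.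
by rewrite mulrAC mulVf ?gt_eqF ?rew_gt0.
Qed.

(** * Explicit sums over the three families and the four boxes *)

Local Ltac distinct_boxes :=
  let e := fresh "e" in
  rewrite !inE ?negb_or -?andbA; repeat (apply/andP; split);
  apply/eqP => /setP e;
  move: (e box1) (e box2) (e box3) (e box4); rewrite !inE; by [].

Section Families.
Variables (R : realFieldType) (f : {set 'I_4} -> R).

Lemma sum_familyA : \sum_(S in familyA) f S =
  f [set box1] + f [set box2] + f [set box3] + f [set box4].
Proof.
rewrite /familyA -!setUA !big_setU1 ?big_set1; first by rewrite /= !addrA.
all: by distinct_boxes.
Qed.

Lemma sum_familyB : \sum_(S in familyB) f S =
  f [set box1] + f [set box2] + f [set box3; box4].
Proof.
rewrite /familyB -!setUA !big_setU1 ?big_set1; first by rewrite /= !addrA.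
all: by distinct_boxes.
Qed.

Lemma sum_familyC : \sum_(S in familyC) f S =
  f [set box1] + f [set box2] + f [set box3]
  + f [set box1; box4] + f [set box2; box4] + f [set box3; box4].
Proof.
rewrite /familyC -!setUA !big_setU1 ?big_set1; first by rewrite /= !addrA.
all: by distinct_boxes.
Qed.

End Families.

Lemma big_box (T : Type) (idx : T) (op : Monoid.law idx) (F : 'I_4 -> T) :
  \big[op/idx]_i F i = op (op (op (F box1) (F box2)) (F box3)) (F box4).
Proof.
rewrite !big_ord_recr big_ord0 /= Monoid.mul1m.
by congr (op (op (op (F _) (F _)) (F _)) (F _)); apply: val_inj.
Qed.

Lemma forall_box (P : 'I_4 -> Prop) :
  P box1 -> P box2 -> P box3 -> P box4 -> forall i, P i.
Proof.
move=> P1 P2 P3 P4 [[|[|[|[|//]]]] lti];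
by [rewrite (_ : Ordinal lti = box1) //; apply: val_inj
   |rewrite (_ : Ordinal lti = box2) //; apply: val_inj
   |rewrite (_ : Ordinal lti = box3) //; apply: val_inj
   |rewrite (_ : Ordinal lti = box4) //; apply: val_inj].
Qed.

Lemma card_box (H : {set 'I_4}) : #|H| =
  ((box1 \in H) + (box2 \in H) + (box3 \in H) + (box4 \in H))%N.
Proof. by rewrite -sum1_card big_mkcond big_box /=; do 4! case: (_ \in H). Qed.

Lemma disjoint_set2 (T : finType) (i j : T) (H : {set T}) :
  [disjoint [set i; j] & H] = (i \notin H) && (j \notin H).
Proof. by rewrite -setI_eq0 setIUl setU_eq0 !setI_eq0 !disjoints1. Qed.

(** * Finitely supported mixed strategies *)

Section Mixture.
Variables (R : realFieldType) (B : finType) (s : seq (R * B)).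

Definition mixture : {ffun B -> R} :=
  [ffun b => \sum_(e <- s) e.1 * (b == e.2)%:R].

Lemma sum_mixture (f : B -> R) :
  \sum_b mixture b * f b = \sum_(e <- s) e.1 * f e.2.
Proof.
under eq_bigr => b _ do rewrite ffunE mulr_suml.
rewrite exchange_big; apply: eq_bigr => e _ /=.
rewrite (bigD1 e.2) //= eqxx mulr1 big1 ?addr0 // => b /negPf->.
by rewrite mulr0 mul0r.
Qed.

Lemma mixed_mixture (Y : {set B}) :
  all (fun e => (0 <= e.1) && (e.2 \in Y)) s -> \sum_(e <- s) e.1 = 1 ->
  mixed Y mixture.
Proof.
move=> /allP sY s1; split=> [b|b bY|].
- rewrite ffunE big_seq; apply: sumr_ge0 => e /sY /andP[e0 _].
  by rewrite mulr_ge0.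
- rewrite ffunE big_seq big1 // => e /sY /andP[_ eY].
  by rewrite (_ : b == e.2 = false) ?mulr0 //; apply: contraNF bY => /eqP->.
- rewrite -s1 -[RHS](eq_bigr _ (fun e _ => mulr1 e.1)) -(sum_mixture (fun=> 1)).
  by apply: eq_bigr => b _; rewrite mulr1.
Qed.

End Mixture.

(** * From fractional edge packings to Hider strategies *)

Section Packing.
Variables (R : realFieldType) (r : 'I_4 -> R).
Let r1 := r box1.
Let r2 := r box2.
Let r3 := r box3.
Let r4 := r box4.

(** Each [xij] is [M] times the probability that boxes i and j are the trap-free pair. *)
Definition packing (M : R) : Prop :=
  exists x12 x13 x14 x23 x24 x34,
  [/\ [/\ 0 <= x12, 0 <= x13 & 0 <= x14] /\
        [/\ 0 <= x23, 0 <= x24 & 0 <= x34],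
      [/\ x12 <= (r1 + r2)^-1, x13 <= (r1 + r3)^-1 & x14 <= (r1 + r4)^-1] /\
        [/\ x23 <= (r2 + r3)^-1, x24 <= (r2 + r4)^-1 & x34 <= (r3 + r4)^-1],
      [/\ x12 + x13 + x14 <= r1^-1, x12 + x23 + x24 <= r2^-1,
          x13 + x23 + x34 <= r3^-1 & x14 + x24 + x34 <= r4^-1]
    & x12 + x13 + x14 + x23 + x24 + x34 = M].

Lemma packing_secures M : (forall i, 0 < r i) -> 0 < M -> packing M ->
  exists q, min_secures (complete_hypergraph 4) (hider_pure 4 2) (payoff r) q M^-1.
Proof.
move=> r_gt0 M_gt0 [x12 [x13 [x14 [x23 [x24 [x34]]]]]].
move=> [[[p12 p13 p14] [p23 p24 p34]] [[c12 c13 c14] [c23 c24 c34]] [d1 d2 d3 d4] xM].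
have M_ge0 : 0 <= M^-1 by rewrite invr_ge0 ltW.
(* The weight of an edge goes to the complementary pair, which holds the traps. *)
pose s := [:: (x12 / M, [set box3; box4]); (x13 / M, [set box2; box4]);
              (x14 / M, [set box2; box3]); (x23 / M, [set box1; box4]);
              (x24 / M, [set box1; box3]); (x34 / M, [set box1; box2])].
exists (mixture s); apply: min_securesP.
  apply: mixed_mixture; last first.
    by rewrite /s !big_cons big_nil /= addr0 -!mulrDl !addrA xM divff ?gt_eqF.
  by rewrite /= !inE !cards2 /= !mulr_ge0.
move=> S _; rewrite sum_mixture /s !big_cons big_nil /= addr0 /payoff.
rewrite ![disjoint (mem S) _]disjoint_sym !disjoint_set2 /reward big_mkcond big_box /=.
have [g1 g2 g3 g4] : [/\ 0 < r1, 0 < r2, 0 < r3 & 0 < r4] by split; apply: r_gt0.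
have deg (t x : R) : 0 < t -> x <= t^-1 -> x * t <= 1.
  by move=> t0 xt; rewrite -ler_pdivlMr // div1r.
have k12 := deg _ _ (addr_gt0 g1 g2) c12.
have k13 := deg _ _ (addr_gt0 g1 g3) c13.
have k14 := deg _ _ (addr_gt0 g1 g4) c14.
have k23 := deg _ _ (addr_gt0 g2 g3) c23.
have k24 := deg _ _ (addr_gt0 g2 g4) c24.
have k34 := deg _ _ (addr_gt0 g3 g4) c34.
have {deg} [[[e1 e2] e3] e4] := (deg _ _ g1 d1, deg _ _ g2 d2, deg _ _ g3 d3, deg _ _ g4 d4).
rewrite -/r1 -/r2 -/r3 -/r4.
have cancel_M x v : x / M * v * M = x * v by rewrite mulrAC divfK ?gt_eqF.
rewrite -[leRHS]div1r ler_pdivlMr // !mulrDl !cancel_M.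
(* A singleton [S] meets a degree bound and a pair meets a capacity; the empty set and sets of three
   or more boxes pay nothing. *)
by case: (box1 \in S); case: (box2 \in S); case: (box3 \in S);
  case: (box4 \in S) => /=; lra.
Qed.

End Packing.

(** * Inequalities between inverses, and splitting a sum between bounds *)

Section Inverses.
Variable R : realFieldType.
Implicit Types x y t : R.

Lemma inv_pair_ge x y : 0 < y -> y <= x -> x^-1 / 2 <= (x + y)^-1.
Proof.
move=> y0 yx; have x0 := lt_le_trans y0 yx.
by rewrite -invfM lef_pV2 ?posrE ?mulr_gt0 ?addr_gt0 //; lra.
Qed.

Lemma inv_drop x t : 0 < x -> 0 < t ->
  x^-1 - (x + t)^-1 = t * (x * (x + t))^-1.
Proof. by move=> x0 t0; field; rewrite !gt_eqF ?addr_gt0. Qed.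

(** This is convexity of the inverse: in the factored drop only the denominator depends on the base
    point, and it increases. *)
Lemma inv_drop_le x y t : 0 < t -> 0 < y -> y <= x ->
  x^-1 - (x + t)^-1 <= y^-1 - (y + t)^-1.
Proof.
move=> t0 y0 yx; have x0 := lt_le_trans y0 yx.
rewrite !inv_drop // ler_pM2l // lef_pV2 ?posrE ?mulr_gt0 ?addr_gt0 //.
by apply: ler_pM; rewrite ?lerD2r // ltW ?addr_gt0.
Qed.

(** Factor [t] out of the hypothesis and [z] out of the conclusion. Since [t <= z], passing from one
    to the other only shrinks the terms on the left and enlarges the one on the right. *)
Lemma inv_drop_swap x y z t : 0 < t -> t <= z -> z <= y -> y <= x ->
  x^-1 - (x + t)^-1 + (y^-1 - (y + t)^-1) <= z^-1 - (z + t)^-1 ->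
  x^-1 - (x + z)^-1 + (y^-1 - (y + z)^-1) <= t^-1 - (z + t)^-1.
Proof.
move=> t0 tz zy yx.
have z0 := lt_le_trans t0 tz; have y0 := lt_le_trans z0 zy.
have x0 := lt_le_trans y0 yx.
rewrite !inv_drop // -!mulrDr ler_pM2l // => h.
rewrite (addrC z t) inv_drop // ler_pM2l // (addrC t z).
apply: le_trans (_ : (z * (z + t))^-1 <= _).
  apply: le_trans h; apply: lerD; rewrite lef_pV2 ?posrE ?mulr_gt0 ?addr_gt0 //;
  by rewrite ler_pM2l // lerD2l.
by rewrite lef_pV2 ?posrE ?mulr_gt0 ?addr_gt0 // ler_pM2r ?addr_gt0.
Qed.

Lemma split_between (l1 u1 l2 u2 s : R) : l1 <= u1 -> l2 <= u2 ->
  l1 + l2 <= s -> s <= u1 + u2 ->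
  exists x y, [/\ l1 <= x <= u1, l2 <= y <= u2 & x + y = s].
Proof.
(* Take the first summand as small as the bounds allow. *)
move=> h1 h2 hl hu; exists (Num.max l1 (s - u2)), (s - Num.max l1 (s - u2)).
by case: (leP l1 (s - u2)) => h; split; lra.
Qed.

Lemma split_between3 (l1 u1 l2 u2 l3 u3 s : R) :
  l1 <= u1 -> l2 <= u2 -> l3 <= u3 ->
  l1 + l2 + l3 <= s -> s <= u1 + u2 + u3 ->
  exists x y z, [/\ l1 <= x <= u1, l2 <= y <= u2, l3 <= z <= u3 & x + y + z = s].
Proof.
move=> h1 h2 h3 hl hu.
have [||||t [z [ht hz tz]]] := @split_between (l1 + l2) (u1 + u2) l3 u3 s; try lra.
have [||||x [y [hx hy xy]]] := @split_between l1 u1 l2 u2 t; try lra.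
by exists x, y, z; rewrite xy.
Qed.

End Inverses.

(** * Optimal packings in the three regions *)

Section Regions.
Variables (R : realFieldType) (r : 'I_4 -> R).
Let r1 := r box1.
Let r2 := r box2.
Let r3 := r box3.
Let r4 := r box4.
Hypotheses (r12 : r2 <= r1) (r23 : r3 <= r2) (r34 : r4 <= r3) (r4_gt0 : 0 < r4).

Let r3_gt0 : 0 < r3. Proof. exact: lt_le_trans r34. Qed.
Let r2_gt0 : 0 < r2. Proof. exact: lt_le_trans r23. Qed.
Let r1_gt0 : 0 < r1. Proof. exact: lt_le_trans r12. Qed.

Let a1 := r1^-1.
Let a2 := r2^-1.
Let a3 := r3^-1.
Let a4 := r4^-1.
Let c12 := (r1 + r2)^-1.
Let c13 := (r1 + r3)^-1.
Let c14 := (r1 + r4)^-1.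
Let c23 := (r2 + r3)^-1.
Let c24 := (r2 + r4)^-1.
Let c34 := (r3 + r4)^-1.

(** These linear relations among the inverses let [lra] verify the packings below. *)
Let bounds :
  [/\ 0 < a1, a1 <= a2, a2 <= a3 & a3 <= a4] /\
  [/\ a1 / 2 <= c12, a1 / 2 <= c13 & a1 / 2 <= c14] /\
  [/\ a2 / 2 <= c23, a2 / 2 <= c24 & a3 / 2 <= c34] /\
  [/\ c12 <= a1, c13 <= a1 & c14 <= a1] /\
  [/\ c23 <= a2, c24 <= a2 & c34 <= a3] /\
  a1 - c14 <= a2 - c24 <= a3 - c34.
Proof.
have r24 := le_trans r34 r23; have r13 := le_trans r23 r12.
have r14 := le_trans r34 r13.
have le_add x y : 0 < x -> 0 < y -> (x + y)^-1 <= x^-1 :> R.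
  by move=> x0 y0; rewrite lef_pV2 ?posrE ?addr_gt0 // lerDl ltW.
split; first by split; rewrite ?invr_gt0 ?lef_pV2 ?posrE.
do 2! [split; first by split; apply: inv_pair_ge].
do 2! [split; first by split; apply: le_add].
by rewrite !inv_drop_le.
Qed.

Local Ltac fold_packing :=
  rewrite /packing -/r1 -/r2 -/r3 -/r4 -/a1 -/a2 -/a3 -/a4
    -/c12 -/c13 -/c14 -/c23 -/c24 -/c34.

(** Fill the three edges at box 4 to capacity and saturate the degrees of boxes 1, 2, 3; this
    determines the triangle 123. The hypotheses give the degree bound at box 4 and [0 <= x12]. *)
Lemma packingC :
  c14 + c24 + c34 <= a4 -> a3 - c34 <= a1 - c14 + (a2 - c24) ->
  packing r ((a1 + a2 + a3 + c14 + c24 + c34) / 2).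
Proof.
have [[? ? ? ?] [[? ? ?] [[? ? ?] [[? ? ?] [[? ? ?] ?]]]]] := bounds.
move=> h4 h3; fold_packing.
exists ((a1 - c14 + (a2 - c24) - (a3 - c34)) / 2),
       ((a1 - c14 + (a3 - c34) - (a2 - c24)) / 2), c14,
       ((a2 - c24 + (a3 - c34) - (a1 - c14)) / 2), c24, c34.
by repeat split; lra.
Qed.

(** Drop edge 12, fill edge 34, and saturate the degrees of boxes 1 and 2. What remains is to choose
    [x14] and [x24]. *)
Lemma packingB :
  a1 - c14 + (a2 - c24) <= a3 - c34 -> a1 + a2 + c34 *+ 2 <= a3 + a4 ->
  packing r (a1 + a2 + c34).
Proof.
have [[? ? ? ?] [[? ? ?] [[? ? ?] [[? ? ?] [[? ? ?] ?]]]]] := bounds.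
move=> h3 hA; have h4 := inv_drop_swap r4_gt0 r34 r23 r12 h3.
rewrite -/a1 -/a2 -/a4 -/c13 -/c23 -/c34 in h4.
fold_packing.
(* Here [s] is [x14 + x24]. Its lower bounds come from the capacities of 13 and 23 and the degree of
   box 3, its upper bounds from the capacities of 14 and 24 and the degree of box 4. *)
have [s [hs s_ge s_le]] : exists s,
    [/\ a1 - c13 + (a2 - c23) <= s <= c14 + c24, a1 + a2 + c34 - a3 <= s
      & s <= a4 - c34].
  exists (Num.max (a1 - c13 + (a2 - c23)) (a1 + a2 + c34 - a3)).
  by case: (leP _ (a1 + a2 + c34 - a3)) => ?; split; lra.
have [||||x14 [x24 [h14 h24 xs]]] :=
  @split_between R (a1 - c13) c14 (a2 - c23) c24 s; try lra.
exists 0, (a1 - x14), x14, (a2 - x24), x24, c34.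
by repeat split; lra.
Qed.

(* All four degrees are saturated, so opposite edges have prescribed differences
   [x34 - x12], [x24 - x13], [x14 - x23]: the only freedom is how to split
   [x12 + x13 + x23]. *)
Lemma packingA :
  a4 <= c14 + c24 + c34 -> a3 + a4 <= a1 + a2 + c34 *+ 2 ->
  packing r ((a1 + a2 + a3 + a4) / 2).
Proof.
have [[? ? ? ?] [[? ? ?] [[? ? ?] [[? ? ?] [[? ? ?] ?]]]]] := bounds.
move=> h4 hB; fold_packing.
pose d2 := (a3 + a4 - a1 - a2) / 2; pose d3 := (a2 + a4 - a1 - a3) / 2.
pose d4 := (a1 + a4 - a2 - a3) / 2.
have [d2E d3E d4E] : [/\ d2 * 2 = a3 + a4 - a1 - a2, d3 * 2 = a2 + a4 - a1 - a3
    & d4 * 2 = a1 + a4 - a2 - a3] by split; rewrite divfK ?pnatr_eq0.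
(* Each minimum combines the capacities of an edge and its opposite. Only [d4] can be negative,
   hence the lower bound [- d4] on [x23]. The target sum is the total weight minus the degree [a4]
   of box 4. *)
have [|||||x12 [x13 [x23 [h12 h13 h23 xs]]]] :=
  @split_between3 R 0 (Num.min c12 (c34 - d2)) 0 (Num.min c13 (c24 - d3))
    (Num.max 0 (- d4)) (Num.min c23 (c14 - d4)) ((a1 + a2 + a3 - a4) / 2).
- by rewrite le_min; lra.
- by rewrite le_min; lra.
- by rewrite le_min !ge_max; lra.
- by case: (leP 0 (- d4)) => ?; lra.
- by case: (leP c12 _) => ?; case: (leP c13 _) => ?; case: (leP c23 _) => ?; lra.
move: h12 h13 h23; rewrite !le_min ge_max => h12 h13 h23.
exists x12, x13, (x23 + d4), x23, (x13 + d3), (x12 + d2).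
by repeat split; lra.
Qed.

End Regions.

(** * The value and the optimal Searcher strategies *)

Theorem theorem6 (R : realFieldType) (r : 'I_4 -> R)
    (r12 : r box1 >= r box2) (r23 : r box2 >= r box3)
    (r34 : r box3 >= r box4) (r4_gt0 : r box4 > 0) :
  booby_trap_value (complete_hypergraph 4) 2 r
    (Num.max (valueA r) (Num.max (valueB r) (valueC r)))
  /\ [\/ searcher_optimal (complete_hypergraph 4) 2 r (strategyA r),
         searcher_optimal (complete_hypergraph 4) 2 r (strategyB r)
       | searcher_optimal (complete_hypergraph 4) 2 r (strategyC r)].
Proof.
have r3_gt0 := lt_le_trans r4_gt0 r34.
have r2_gt0 := lt_le_trans r3_gt0 r23.
have r1_gt0 := lt_le_trans r2_gt0 r12.
have r_gt0 : forall i, 0 < r i by apply: forall_box.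
(* Every pair of traps misses at least [m] members of the family: two for A and C, one for B. *)
have sec (F : {set {set 'I_4}}) m : set0 \notin F -> [set box1] \in F ->
    (forall H : {set 'I_4}, #|H| = 2 -> m%:R <= \sum_(S in F) [disjoint S & H]%:R :> R) ->
    max_secures (complete_hypergraph 4) (hider_pure 4 2) (payoff r)
      (inverse_reward_strategy r F) (m%:R / \sum_(S in F) (reward r S)^-1).
  move=> F0 F1; apply: inverse_reward_secures => //; first exact: subsetT.
  by apply/set0Pn; exists [set box1].
have secA : max_secures (complete_hypergraph 4) (hider_pure 4 2) (payoff r)
    (strategyA r) (valueA r).
  rewrite /valueA -normalizerA; apply: (sec familyA 2%N).
  - by distinct_boxes.
  - by rewrite !inE eqxx.
  - move=> H; rewrite sum_familyA !disjoints1 card_box.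
    by do 4! case: (_ \in H) => //=; lra.
have secB : max_secures (complete_hypergraph 4) (hider_pure 4 2) (payoff r)
    (strategyB r) (valueB r).
  rewrite /valueB -normalizerB; apply: (sec familyB 1%N).
  - by distinct_boxes.
  - by rewrite !inE eqxx.
  - move=> H; rewrite sum_familyB disjoint_set2 !disjoints1 card_box.
    by do 4! case: (_ \in H) => //=; lra.
have secC : max_secures (complete_hypergraph 4) (hider_pure 4 2) (payoff r)
    (strategyC r) (valueC r).
  rewrite /valueC -normalizerC; apply: (sec familyC 2%N).
  - by distinct_boxes.
  - by rewrite !inE eqxx.
  - move=> H; rewrite sum_familyC !disjoint_set2 !disjoints1 card_box.
    by do 4! case: (_ \in H) => //=; lra.
(* A Hider strategy holding the Searcher to one of the three values bounds the other two, so that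
   value is the maximum. *)
have close p v : max_secures (complete_hypergraph 4) (hider_pure 4 2) (payoff r) p v ->
    v \in [:: valueA r; valueB r; valueC r] ->
    (exists q, min_secures (complete_hypergraph 4) (hider_pure 4 2) (payoff r) q v) ->
    booby_trap_value (complete_hypergraph 4) 2 r
      (Num.max (valueA r) (Num.max (valueB r) (valueC r)))
    /\ searcher_optimal (complete_hypergraph 4) 2 r p.
  move=> pv vABC [q qv]; split; last exact: secures_optimal pv qv.
  suff -> : Num.max (valueA r) (Num.max (valueB r) (valueC r)) = v.
    by split; [exists p | exists q].
  apply/eqP; rewrite eq_le !ge_max.
  rewrite (secures_le secA qv) (secures_le secB qv) (secures_le secC qv) /=.
  by move: vABC; rewrite !inE => /or3P[] /eqP ->; rewrite !le_max lexx ?orbT.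
have hider v M : v = M^-1 -> 0 < M -> packing r M ->
    exists q, min_secures (complete_hypergraph 4) (hider_pure 4 2) (payoff r) q v.
  by move=> -> M0; apply: packing_secures.
(* The tests compare the reciprocals of the three values: the first holds when that of C is least,
   the second when that of A is least. If both fail, that of B is least, which is what [packingB]
   requires. *)
have [hC|hC] := boolP (((r box1 + r box4)^-1 + (r box2 + r box4)^-1
      + (r box3 + r box4)^-1 <= (r box4)^-1)
    && ((r box3)^-1 - (r box3 + r box4)^-1
        <= (r box1)^-1 - (r box1 + r box4)^-1 + ((r box2)^-1 - (r box2 + r box4)^-1))).
  case/andP: hC => h4 h3; case: (close _ _ secC); rewrite ?inE ?eqxx ?orbT //.
    apply: hider (packingC r12 r23 r34 r4_gt0 h4 h3).
      by rewrite invf_div /valueC !div1r.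
    by rewrite divr_gt0 ?addr_gt0 ?invr_gt0 ?addr_gt0.
  by split=> //; apply: Or33.
have [hA|hA] := boolP (((r box4)^-1 <= (r box1 + r box4)^-1 + (r box2 + r box4)^-1
      + (r box3 + r box4)^-1)
    && ((r box3)^-1 + (r box4)^-1
        <= (r box1)^-1 + (r box2)^-1 + (r box3 + r box4)^-1 *+ 2)).
  case/andP: hA => h4 hB; case: (close _ _ secA); rewrite ?inE ?eqxx ?orbT //.
    apply: hider (packingA r12 r23 r34 r4_gt0 h4 hB).
      by rewrite invf_div /valueA !div1r.
    by rewrite divr_gt0 ?addr_gt0 ?invr_gt0 ?addr_gt0.
  by split=> //; apply: Or31.
case: (close _ _ secB); rewrite ?inE ?eqxx ?orbT //; last by split=> //; apply: Or32.
apply: hider (packingB r12 r23 r34 r4_gt0 _ _).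
- by rewrite /valueB !div1r.
- by rewrite ?addr_gt0 ?invr_gt0 ?addr_gt0.
- by move: hC hA; rewrite !negb_and -!ltNge => /orP[] ? /orP[] ?; lra.
- by move: hC hA; rewrite !negb_and -!ltNge => /orP[] ? /orP[] ?; lra.
Qed.
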